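(* Let $N>3$. Then there does not exist an $(N,K,\lambda)$ difference set $\mathcal{K}\subseteq\mathbb{Z}_N$ such that the corresponding Gabor system $\Phi_{\mathcal{K}}=\{M_jT_kv\}_{j,k=0}^{N-1}$, with $v=\frac{1}{\sqrt{K}}\chi_{\mathcal{K}}$, is an equiangular tight frame for $\mathbb{C}^N$.
   Context: $\mathbb{Z}_N=\{0,1,\dots,N-1\}$ with arithmetic modulo $N$; vectors in $\mathbb{C}^N$ are indexed by $\mathbb{Z}_N$, and all index operations are modulo $N$. Difference set: a nonempty subset $\mathcal{K}=\{u_1,\dots,u_K\}\subseteq\mathbb{Z}_N$ with $K$ elements is an $(N,K,\lambda)$ difference set if the $K(K-1)$ differences $(u_k-u_l)\bmod N$, $k\ne l$, take all nonzero values $1,2,\dots,N-1$, each exactly $\lambda$ times. $\chi_{\mathcal{K}}\in\mathbb{C}^N$ is the characteristic function of $\mathcal{K}$: $\chi_{\mathcal{K}}(j)=1$ if $j\in\mathcal{K}$ and $0$ otherwise. Modulation and translation operators on $\mathbb{C}^N$: $(M_jg)(n)=e^{2\pi i jn/N}g(n)$ and $(T_kg)(n)=g(n-k)$ for $n=0,\dots,N-1$. An indexed family $\{\phi_i\}_{i=1}^M$ of nonzero vectors in $\mathbb{C}^N$ is a tight frame if there is $A>0$ with $\sum_{i=1}^M|\langle x,\phi_i\rangle|^2=A\|x\|^2$ for all $x\in\mathbb{C}^N$; it is equiangular if there is a constant $c$ with $|\langle\phi_i,\phi_j\rangle|=c$ for all indices $i\ne j$. An equiangular tight frame is a family that is both.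 For $\Phi_{\mathcal{K}}$ the index set is the set of $N^2$ pairs $(j,k)$. *)

(* Defs.v *)
From HB Require Import structures.
From mathcomp Require Import all_boot all_order all_algebra.
From mathcomp Require Import complex.
From mathcomp Require Import reals trigo.

Set Implicit Arguments.
Unset Strict Implicit.
Unset Printing Implicit Defensive.

Import Order.TTheory GRing.Theory Num.Theory.

Local Open Scope ring_scope.
Local Open Scope complex_scope.

(* Throughout, [R : realType] is the field of real numbers, [R[i]] is the field
   of complex numbers, and vectors of C^N are functions [{ffun 'Z_N -> R[i]}].
   ['Z_N] is the ring of integers modulo N only when [1 < N]: for [N = 0, 1] it
   denotes Z/2. The definitions below are meant to be used with [1 < N]. *)

Section DifferenceSet.
Variable N : nat.

(* For [d != 0], the pairs counted are automatically pairs of distinct elements.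
   [lam = 0] is not excluded, so that a singleton is an (N, 1, 0) difference
   set. *)
Definition difference_set (K lam : nat) (D : {set 'Z_N}) : Prop :=
  [/\ D != set0, #|D| = K &
      forall d : 'Z_N, d != 0 ->
        #|[set p : 'Z_N * 'Z_N |
             [&& p.1 \in D, p.2 \in D, p.1 != p.2 & p.1 - p.2 == d]]| = lam].

End DifferenceSet.

Section Frames.
Variables (R : realType) (T I : finType).
Implicit Types (x y : {ffun T -> R[i]}) (phi : I -> {ffun T -> R[i]}).

Definition inner x y : R[i] := \sum_t x t * (y t)^*.

Definition vnorm x : R[i] := sqrtC (inner x x).

(* In [R[i]], [0 < A] means that [A] is real and positive. *)
Definition tight_frame phi : Prop :=
  (forall i, phi i != 0) /\
  exists2 A : R[i], 0 < A &
    forall x, \sum_i `|inner x (phi i)| ^+ 2 = A * vnorm x ^+ 2.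

Definition equiangular phi : Prop :=
  exists c : R[i], forall i j, i != j -> `|inner (phi i) (phi j)| = c.

Definition equiangular_tight_frame phi : Prop :=
  tight_frame phi /\ equiangular phi.

End Frames.

Section Gabor.
Variables (R : realType) (N : nat).
Implicit Types (g : {ffun 'Z_N -> R[i]}) (D : {set 'Z_N}).

(* exp (i theta) *)
Definition expi (theta : R) : R[i] := cos theta +i* sin theta.

(* [(j * n)%N] is the product of the representatives in {0, ..., N-1}. *)
Definition modulation (j : 'Z_N) g : {ffun 'Z_N -> R[i]} :=
  [ffun n : 'Z_N => expi (2 * pi * (j * n)%N%:R / N%:R) * g n].

Definition translation (k : 'Z_N) g : {ffun 'Z_N -> R[i]} :=
  [ffun n : 'Z_N => g (n - k)].

Definition char_fun D : {ffun 'Z_N -> R[i]} :=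
  [ffun j : 'Z_N => (j \in D)%:R].

Definition gabor_system g (jk : 'Z_N * 'Z_N) : {ffun 'Z_N -> R[i]} :=
  modulation jk.1 (translation jk.2 g).

Definition gabor_window D : {ffun 'Z_N -> R[i]} :=
  [ffun n : 'Z_N => (sqrtC #|D|%:R)^-1 * char_fun D n].

End Gabor.

(* Main.v *)
Require Import Defs.
From mathcomp Require Import all_boot all_order all_algebra.
From mathcomp Require Import complex.
From mathcomp Require Import ring lra zify.
From mathcomp Require Import reals trigo.

(** Write [v] for the normalised window and [c] for the common modulus of the
inner products of distinct members of the Gabor system.  Two of these inner
products already force [lam <= 1], and tightness then leaves only [N = 3].

The translates [T_1 v] and [v] overlap in exactly [lam] points, where both
vectors are equal to [1 / sqrt K], so [c = lam / K].  On the other hand, the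
inner product of [M_1 T_1 v] with [v] is [1 / K] times the sum of the phases
[exp (2 pi i n / N)] over the same [lam] points.  Its modulus is also [lam / K],
so the triangle inequality for that sum of unit complex numbers is an equality.
All these phases then coincide, but distinct points of [Z_N] have distinct
phases; hence [lam <= 1] ([equiangular_lam_le1]).

Evaluating the tight frame identity at a point mass shows that the frame bound
is [N]; evaluating it at the unit vector [v] gives
[1 + (N ^ 2 - 1) (lam / K) ^ 2 = N], that is, [(N + 1) lam ^ 2 = K ^ 2]
([etf_gabor_card]).  Counting differences gives [K ^ 2 = K + (N - 1) lam]
([difference_set_card]).  For [lam = 0] the first equation contradicts [0 < K];
for [lam = 1] the two equations give [K = 2] and [N = 3]. *)

Set Implicit Arguments.
Unset Strict Implicit.
Unset Printing Implicit Defensive.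

Import Order.TTheory GRing.Theory Num.Theory.

Section Overlaps.
Local Open Scope ring_scope.
Variable N : nat.
Implicit Types (D : {set 'Z_N}) (d : 'Z_N).

(** The intersection of [D] with its translate by [d], i.e. the common support of
[chi_D] and [T_d chi_D]. *)
Definition overlap D d := [set n in D | n - d \in D].

Lemma overlap0 D : overlap D 0 = D.
Proof. by apply/setP => n; rewrite inE subr0 andbb. Qed.

(** A point [n] of the overlap is the same thing as a pair [(n, n - d)] of
elements of [D] with difference [d]. *)
Lemma card_overlap D K lam d :
  difference_set K lam D -> d != 0 -> #|overlap D d| = lam.
Proof.
case=> _ _ hlam d0; rewrite -(hlam d d0).
rewrite -(card_imset _ (f := fun n => (n, n - d))) => [|x y [] //].
apply: eq_card => -[p q]; rewrite inE /=.
apply/imsetP/and4P => [[n] | [pD qD pq /eqP dE]].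
  rewrite inE => /andP[nD ndD] [-> ->]; split=> //.
    by rewrite -subr_eq0 subKr.
  by rewrite subKr.
by exists p; rewrite ?inE -dE subKr ?pD.
Qed.

(** Both sides count the ordered pairs of elements of [D], on the left according
to their difference. *)
Lemma sum_card_overlap D : (\sum_d #|overlap D d| = #|D| ^ 2)%N.
Proof.
under eq_bigr do rewrite -sum1dep_card big_mkcondr.
rewrite exchange_big /= -mulnn -sum_nat_const; apply: eq_bigr => n _.
rewrite -big_mkcond sum1dep_card -(card_imset (mem D) (subrI n)).
apply: eq_card => d; rewrite inE; apply/idP/imsetP => [ndD | [m mD ->]].
  by exists (n - d); rewrite ?subKr.
by rewrite subKr.
Qed.

Lemma difference_set_card D K lam : (1 < N)%N -> difference_set K lam D ->
  (K ^ 2 = K + (N - 1) * lam)%N.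
Proof.
move=> N1 hD; have [_ DK _] := hD.
rewrite -{1}DK -sum_card_overlap (bigD1 0) //= overlap0 DK.
congr (_ + _)%N.
rewrite (eq_bigr (fun _ => lam)) => [|d d0]; last exact: card_overlap hD d0.
by rewrite sum_nat_const cardC1 card_ord Zp_cast // subn1.
Qed.

End Overlaps.

Section Phases.
Local Open Scope ring_scope.
Local Open Scope complex_scope.
Variable R : realType.

Lemma norm_expi (t : R) : `|expi t| = 1.
Proof. by rewrite normc_def /= cos2Dsin2 sqrtr1. Qed.

Lemma expi0 : expi (0 : R) = 1.
Proof. by rewrite /expi cos0 sin0. Qed.

(** Equal phases would give [cos (t - s) = 1], hence [sin ((t - s) / 2) = 0],
although [(t - s) / 2] lies strictly between [0] and [pi]. *)
Lemma expi_lt_neq (s t : R) : s < t < s + 2 * pi -> expi s != expi t.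
Proof.
move=> st; apply/eqP => -[ec es].
have : cos (((t - s) / 2) *+ 2) = 1.
  have -> : ((t - s) / 2) *+ 2 = t - s by rewrite -mulr_natr; field.
  by rewrite cosB ec es -!expr2 cos2Dsin2.
rewrite cos_mulr2n cos2sin2 => h.
have : 0 < sin ((t - s) / 2) by apply: sin_gt0_pi; lra.
nra.
Qed.

Lemma expi_roots_of_unity_inj N (m n : nat) : (m < N)%N -> (n < N)%N ->
  expi (2 * pi * m%:R / N%:R : R) = expi (2 * pi * n%:R / N%:R) -> m = n.
Proof.
wlog mn : m n / (m < n)%N.
  move=> wl mN nN e; case: (ltngtP m n) => // h; first exact: wl.
  by apply/esym/wl.
move=> mN nN e.
suff lt_mn : let angle k : R := 2 * pi * k%:R / N%:R in
    angle m < angle n < angle m + 2 * pi.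
  by have := expi_lt_neq lt_mn; rewrite e eqxx.
move=> /=.
have pi0 : 0 < pi :> R := pi_gt0 R.
have N0 : 0 < N%:R :> R by rewrite ltr0n; lia.
have mn' : m%:R < n%:R :> R by rewrite ltr_nat.
have nN' : n%:R < N%:R + m%:R :> R by rewrite -natrD ltr_nat; lia.
rewrite ltr_pM2r ?invr_gt0 // ltr_pM2l ?mn' //=; last by lra.
rewrite ltr_pdivrMr // (mulrDl _ _ N%:R) divfK ?lt0r_neq0 // -mulrDr.
rewrite ltr_pM2l; lra.
Qed.

End Phases.

Section GaborProducts.
Local Open Scope ring_scope.
Local Open Scope complex_scope.
Variables (R : realType) (N : nat) (N1 : (1 < N)%N).
Variables (K lam : nat) (D : {set 'Z_N}) (hD : difference_set K lam D).

Let phi := gabor_system (gabor_window R D).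

Lemma gabor_system_entry jk n :
  phi jk n = expi (2 * pi * (jk.1 * n)%N%:R / N%:R)
             * ((sqrtC K%:R)^-1 * (n - jk.2 \in D)%:R).
Proof. by have [_ <- _] := hD; rewrite !ffunE. Qed.

Lemma difference_set_gt0 : (0 < K)%N.
Proof. by have [D0 <- _] := hD; rewrite card_gt0. Qed.

(** Comparing with the undisplaced window [phi (0, 0) = v] is enough for the whole
argument: the modulus of such a product sees only the phases on the overlap of
the two supports. *)
Lemma inner_gabor_origin jk : inner (phi jk) (phi (0, 0)) =
  K%:R^-1 * \sum_(n in overlap D jk.2) expi (2 * pi * (jk.1 * n)%N%:R / N%:R).
Proof.
rewrite /inner mulr_sumr [RHS]big_mkcond /=; apply: eq_bigr => n _.
rewrite !gabor_system_entry /= mul0n mulr0 mul0r expi0 mul1r subr0 inE.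
rewrite geC0_conj ?mulr_ge0 ?invr_ge0 ?sqrtC_ge0 ?ler0n //.
have KE : K%:R^-1 = (sqrtC K%:R)^-1 * (sqrtC K%:R)^-1 :> R[i].
  by rewrite -invfM -expr2 sqrtCK.
rewrite KE; do 2!case: (_ \in D); rewrite ?(mulr1, mulr0, mul0r) //=.
by rewrite -mulrA mulrC.
Qed.

Lemma inner_gabor_translate k : inner (phi (0, k)) (phi (0, 0)) =
  #|overlap D k|%:R / K%:R.
Proof.
rewrite inner_gabor_origin mulrC /= (eq_bigr (fun=> 1)) ?sumr_const // => n _.
by rewrite mul0n mulr0 mul0r expi0.
Qed.

Lemma inner_gabor_origin_self : inner (phi (0, 0)) (phi (0, 0)) = 1.
Proof.
rewrite inner_gabor_translate overlap0; have [_ -> _] := hD.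
by rewrite divff // pnatr_eq0 -lt0n difference_set_gt0.
Qed.

(** The constant of equiangularity is read off the pure translate by [1], whose
overlap with the window carries no phase. *)
Lemma equiangular_gabor_norm jk : equiangular phi -> jk != (0, 0) ->
  `|inner (phi jk) (phi (0, 0))| = lam%:R / K%:R.
Proof.
case=> c hc jk0; rewrite (hc _ _ jk0) -(hc (0, 1) (0, 0) isT).
rewrite inner_gabor_translate (card_overlap hD) //.
by rewrite normf_div !normr_nat.
Qed.

(** For the index [(1, 1)], equiangularity says that the sum of the [lam] phases
over the overlap has modulus [lam].  Equality in the triangle inequality forces
the phases, hence the points, to be all equal. *)
Lemma equiangular_lam_le1 : equiangular phi -> (lam <= 1)%N.
Proof.
move=> /equiangular_gabor_norm eqn.
have /eqn : (1, 1) != (0, 0) :> 'Z_N * 'Z_N by [].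
rewrite inner_gabor_origin normrM normfV normr_nat [RHS]mulrC.
have K0 : K%:R^-1 != 0 :> R[i].
  by rewrite invr_eq0 pnatr_eq0 -lt0n difference_set_gt0.
move=> /(mulfI K0) /= {}eqn.
have [||t _ tE] := normC_sum_eq1 (P := mem (overlap D 1))
    (F := fun n : 'Z_N => expi (2 * pi * (1%R * n)%N%:R / N%:R : R)).
- rewrite [LHS]eqn (eq_bigr (fun=> 1)) => [|n _]; last exact: norm_expi.
  by rewrite sumr_const (card_overlap hD).
- by move=> n _; apply: norm_expi.
rewrite -(card_overlap hD (oner_neq0 _)); apply/card_le1_eqP => m n mS nS.
apply/val_inj/(@expi_roots_of_unity_inj R N).
- by rewrite -[ltnRHS](Zp_cast N1) ltn_ord.
- by rewrite -[ltnRHS](Zp_cast N1) ltn_ord.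
by have := etrans (tE m mS) (esym (tE n nS)); rewrite !mul1n.
Qed.

Definition delta (t : 'Z_N) : {ffun 'Z_N -> R[i]} := [ffun n => (n == t)%:R].

Lemma inner_delta t x : inner (delta t) x = (x t)^*.
Proof.
rewrite /inner (bigD1 t) //= big1 => [|n /negPf nt]; rewrite ffunE.
  by rewrite eqxx mul1r addr0.
by rewrite nt mul0r.
Qed.

Lemma card_Zp : #|'Z_N| = N.
Proof. by rewrite card_ord Zp_cast. Qed.

(** Modulations do not change moduli, and summing over the translations moves
[t] across the whole window, which has norm 1; so each of the [N] modulations
contributes 1. *)
Lemma sum_sqr_gabor_entry (t : 'Z_N) : \sum_jk `|phi jk t| ^+ 2 = N%:R.
Proof.
have [_ DK _] := hD.
rewrite -(pair_bigA _ (fun j k => `|phi (j, k) t| ^+ 2)) /=.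
rewrite (eq_bigr (fun=> 1)) ?sumr_const ?card_Zp // => j _.
rewrite (reindex_inj (subrI t)) /=.
rewrite (eq_bigr (fun n => if n \in D then K%:R^-1 else 0)) => [|k _].
  rewrite -big_mkcond sumr_const DK -[LHS]mulr_natl divff // pnatr_eq0 -lt0n.
  exact: difference_set_gt0.
rewrite gabor_system_entry normrM norm_expi mul1r subKr.
case: (k \in D); rewrite ?mulr1 ?mulr0 ?normr0 ?expr0n //.
rewrite ger0_norm ?invr_ge0 ?sqrtC_ge0 ?ler0n //.
by rewrite exprVn sqrtCK.
Qed.

(** The frame bound is found to be [N] by testing the frame identity on a point
mass; the identity is then applied to the unit vector [phi (0, 0)]. *)
Lemma tight_gabor_energy : tight_frame phi ->
  \sum_jk `|inner (phi (0, 0)) (phi jk)| ^+ 2 = N%:R.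
Proof.
case=> _ [A _ hA].
have AN : A = N%:R.
  have := hA (delta 0); rewrite /vnorm sqrtCK !inner_delta ffunE eqxx.
  rewrite rmorph1 mulr1 => <-; rewrite -(sum_sqr_gabor_entry 0).
  by apply: eq_bigr => jk _; rewrite inner_delta norm_conjC.
by rewrite hA /vnorm sqrtCK inner_gabor_origin_self mulr1.
Qed.

Lemma inner_conj (x y : {ffun 'Z_N -> R[i]}) : inner x y = (inner y x)^*.
Proof.
rewrite /inner rmorph_sum; apply: eq_bigr => t _.
by rewrite rmorphM [RHS]mulrC; congr (_ * _); exact/esym/conjCK.
Qed.

(** In the energy of [phi (0, 0)] its own term is 1, and each of the [N ^ 2 - 1]
others is [(lam / K) ^ 2]; the factor [N - 1] common to [N - 1] and [N ^ 2 - 1]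
cancels. *)
Lemma etf_gabor_card : equiangular_tight_frame phi ->
  ((N + 1) * lam ^ 2 = K ^ 2)%N.
Proof.
case=> /tight_gabor_energy hN /equiangular_gabor_norm hc.
move: hN; rewrite (bigD1 (0, 0)) //= inner_gabor_origin_self normr1 expr1n.
rewrite (eq_bigr (fun=> (lam%:R / K%:R) ^+ 2)) => [|jk jk0]; last first.
  by rewrite inner_conj norm_conjC hc.
rewrite sumr_const cardC1 card_prod card_Zp.
have K0 : K%:R != 0 :> R[i] by rewrite pnatr_eq0 -lt0n difference_set_gt0.
rewrite expr_div_n -[_ *+ (N * N).-1]mulr_natr => /(congr1 ( *%R^~ (K%:R ^+ 2))).
rewrite mulrDl mul1r mulrAC divfK ?expf_neq0 // -!natrX -!natrM -natrD.
move/eqP; rewrite eqr_nat => /eqP e.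
apply/eqP; rewrite -(eqn_pmul2l (m := N - 1)) ?subn_gt0 //; apply/eqP.
have NN : ((N * N).-1 = (N - 1) * (N + 1))%N by nia.
rewrite mulnA -NN; nia.
Qed.

End GaborProducts.

Theorem proposition2p11 (R : realType) (N : nat) (hN : (3 < N)%N) :
  ~ exists (K lam : nat) (D : {set 'Z_N}),
      difference_set K lam D /\
      equiangular_tight_frame (gabor_system (gabor_window R D)).
Proof.
case=> K [lam [D [hD etf]]].
have N1 : (1 < N)%N by apply: leq_trans hN.
have K0 := difference_set_gt0 hD.
have lam1 := equiangular_lam_le1 N1 hD etf.2.
have := etf_gabor_card N1 hD etf.
have := difference_set_card N1 hD.
case: lam lam1 {hD} => [|[|//]] _; nia.
Qed.
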